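(* Let $M=M[\mathcal{I}]$ be a multi-path matroid of rank $r$ and nullity $m$ on $[m+r]$, presented by an antichain $\mathcal{I}$ of $\sigma$-intervals where $\sigma=(1,2,\ldots,m+r)$, and let $D=D(\mathcal{I},1)$ with points $p_1,\ldots,p_k$, $p'_1,\ldots,p'_k$, bottom border $P$ and top border $Q$. Let $B$ be a basis of $M$ and let $\Pi(B,p_i)$ be a valid path. Activities are taken with respect to the order $1<2<\cdots<m+r$. (I) An element $u\in B$ is internally active if and only if either (a) $\{1,\ldots,u\}\subseteq B$, or (b) the $u$-th step of $\Pi(B,p_i)$ lies in $Q$ and $(u,m+r]\Pi(B,p_i)$ touches $P$. (II) An element $u\notin B$ is externally active if and only if either (a) $\{1,\ldots,u\}\cap B=\emptyset$, or (b) the $u$-th step of $\Pi(B,p_i)$ lies in $P$ and $(u,m+r]\Pi(B,p_i)$ touches $Q$.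
   Context: Transversal matroids: for a multiset $\mathcal{A}=(A_j:j\in J)$ of subsets of a finite set $S$, the sets $\{x_k:k\in K\}$ of $|K|$ distinct elements with $K\subseteq J$, $x_k\in A_k$, are the independent sets of the matroid $M[\mathcal{A}]$ (a presentation of it). For a cyclic permutation $\sigma$ of $S$, a $\sigma$-interval is a nonempty set $[f,l]=\{f,\sigma(f),\ldots,l\}$ with first element $f$ and last element $l$. $\mathcal{I}$ is an antichain (no member contains another) of $r$ $\sigma$-intervals presenting $M$; $M$ has rank $r$, ground set size $m+r$. Diagram $D=D(\mathcal{I},1)$: let $k-1$ be the number of intervals $I\in\mathcal{I}$ with $1\in I$ and $1\neq f_I$. For $1\le i\le k$ put $p_i=(k-i,i-1)$ and $p'_i=p_i+(m,r)$; let $L,L'$ be the lines of slope $-1$ containing the $p_i$, resp. the $p'_i$. Let $P$ be the lattice path from $p_1$ to $p'_1$ whose $t$-th step ($1\le t\le m+r$) is North if $t$ is the last element of some interval of $\mathcal{I}$ and East otherwise; let $Q$ be the lattice path from $p_k$ to $p'_k$ whose $t$-th step is North if $t$ is the first element of some interval of $\mathcal{I}$ and East otherwise. The region of $D$ is the closed region bounded by $L,L',P,Q$. For $X\subseteq[m+r]$ and a lattice point $p$, $\Pi(X,p)$ is the path of $m+r$ unit steps starting at $p$ whose $u$-th step is North if $u\in X$ and East otherwise; a path is valid if it lies entirely in the region of $D$. (By a known result, $B$ is a basis of $M$ iff $\Pi(B,p_i)$ is valid and ends at $p'_i$ for some $i$.) For $v\le u+1$, $[v,u]\Pi(X,p)$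 is the portion of $\Pi(X,p)$ from the beginning of its $v$-th step to the end of its $u$-th step; $(v,u]$, $[v,u)$, $(v,u)$ are the analogous portions starting at the end of step $v$ and/or ending at the beginning of step $u$. A path touches $P$ (resp. $Q$) if it shares a point with it; a step lies in $P$ if it is an edge of $P$. For a basis $B$ (w.r.t. a linear order $<$), $u\in B$ is internally active if there is no $v\notin B$ with $v<u$ and $(B-u)\cup v$ a basis; $u\notin B$ is externally active if there is no $v\in B$ with $v<u$ and $(B-v)\cup u$ a basis. *)

(* Defs.v *)
From mathcomp Require Import all_boot.

Set Implicit Arguments.
Unset Strict Implicit.
Unset Printing Implicit Defensive.

(* A matroid on S is given by its predicate of independent sets. *)
Section Matroid.
Variables (S : finType) (indep : pred {set S}).

Definition basis (B : {set S}) : bool := maxset indep B.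

Definition rank : nat := \max_(X : {set S} | indep X) #|X|.

Definition nullity : nat := #|S| - rank.

Definition internally_active (lt : rel S) (B : {set S}) (u : S) : Prop :=
  u \in B /\
  ~ exists v : S, [/\ v \notin B, lt v u & basis (v |: (B :\ u))].

Definition externally_active (lt : rel S) (B : {set S}) (u : S) : Prop :=
  u \notin B /\
  ~ exists v : S, [/\ v \in B, lt v u & basis (u |: (B :\ v))].

End Matroid.

(* M[A] for A = (A_j : j in J): X is independent when X = {x_k : k in K} for
   some K included in J and distinct x_k in A_k. *)
Definition transversal_matroid (S J : finType) (A : J -> {set S}) :
    pred {set S} :=
  fun X => [exists K : {set J}, exists x : {ffun {k : J | k \in K} -> S},
    [&& injectiveb x,
        [forall k, x k \in A (val k)]
      & X == [set x k | k : {k : J | k \in K}]]].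

(* [f, l] = {f, sigma f, sigma (sigma f), ..., l} *)
Definition sigma_interval (S : finType) (sigma : S -> S) (f l : S) : {set S} :=
  [set x in traject sigma f (findex sigma f l).+1].

Definition antichain (S J : finType) (A : J -> {set S}) : Prop :=
  forall i j : J, i != j -> ~~ (A i \subset A j).

(* A lattice path is the function giving its point after t steps; all the paths
   considered here have non-negative coordinates. *)
Definition point : Type := (nat * nat)%type.
Definition lattice_path : Type := nat -> point.

Definition east (q : point) : point := (q.1.+1, q.2).
Definition north (q : point) : point := (q.1, q.2.+1).

(* Throughout, the element t of [n] = {1, ..., n} is the ordinal of value t - 1
   in 'I_n, so that the step of a path associated with u : 'I_n goes from its
   point number u to its point number u.+1. *)
Definition Pi (n : nat) (X : {set 'I_n}) (p : point) : lattice_path :=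
  fun t => foldl (fun q u => if u \in X then north q else east q)
                 p (take t (enum 'I_n)).

(* The portion (u, n] of W shares a point with R, both of n steps.  Two lattice
   paths that share a point share a lattice point. *)
Definition touches_after (n : nat) (W : lattice_path) (u : 'I_n)
    (R : lattice_path) : Prop :=
  exists t s : nat, [/\ u < t, t <= n, s <= n & W t = R s].

Definition step_lies_in (n : nat) (W : lattice_path) (u : 'I_n)
    (R : lattice_path) : Prop :=
  exists s : nat, [/\ s < n, W u = R s & W u.+1 = R s.+1].

(* I j = (f, l) stands for the interval [f, l] with respect to the cyclic
   permutation sigma = (1, 2, ..., n), which is ordS.  The endpoints are kept as
   data because the set [n] itself is an interval with n possible first
   elements. *)
Section Diagram.
Variables (n r : nat) (I : 'I_r -> 'I_n * 'I_n).

Definition fst_elt (j : 'I_r) : 'I_n := (I j).1.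
Definition lst_elt (j : 'I_r) : 'I_n := (I j).2.

Definition interval (j : 'I_r) : {set 'I_n} :=
  sigma_interval (@ordS n) (fst_elt j) (lst_elt j).

(* e ranges over the only possible element "1" of [n], absent if n = 0. *)
Definition diag_k : nat :=
  #|[set j : 'I_r | [exists e : 'I_n,
      [&& val e == 0, e \in interval j & e != fst_elt j]]]|.+1.

(* p_i, for 1 <= i <= k *)
Definition diag_pt (i : nat) : point := (diag_k - i, i - 1).

Definition bottom_border : lattice_path :=
  Pi [set lst_elt j | j : 'I_r] (diag_pt 1).

Definition top_border : lattice_path :=
  Pi [set fst_elt j | j : 'I_r] (diag_pt diag_k).

(* The lattice points q of the closed region bounded by L, L', P and Q.  The
   lines of slope -1 between L and L' through lattice points are those of
   equation x + y = k - 1 + t with t <= n; such a line meets P and Q exactly in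
   their points number t, and q has to lie on the segment from one to the
   other. *)
Definition in_region (q : point) : Prop :=
  exists2 t : nat, t <= n &
    [/\ q.1 + q.2 = diag_k - 1 + t,
        (top_border t).1 <= q.1 <= (bottom_border t).1
      & (bottom_border t).2 <= q.2 <= (top_border t).2].

(* A unit step lies in the region as soon as its two endpoints do. *)
Definition valid_path (W : lattice_path) : Prop :=
  forall t : nat, t <= n -> in_region (W t).

End Diagram.

(* Main.v *)
(** Write [b_t], [lam_t], [phi_t] for the number of elements of [B], of last
    elements and of first elements below [t], and [c = k - 1] for the number of
    intervals that wrap around.  The path [Pi (B, p_(s+1))] is valid iff
    [lam_t <= s + b_t <= c + phi_t] for all [t], and an [r]-set [B] is a basis
    iff this holds for some [s].  If [B] is a transversal [{y_j}], each interval
    contributes at least as much to [c + phi_t' + b_t] as to [lam_t + b_t'], so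
    every lower bound on [s] is at most every upper bound.  Conversely,
    antichains make the order by first elements a rotation by [c] of the order by
    last elements, and matching the [q]-th element of [B] with the interval whose
    last element has rank [q + s] modulo [r] gives a transversal.

    Exchanging [u] for a smaller [v] shifts [b] by one exactly between [v] and
    [u].  If the exchange is possible at all, then it is so without changing [s]
    and with the largest candidate [v], or with [s] shifted by one and the
    smallest candidate [v]; failure of both is condition (b). *)

Require Import Defs.
From mathcomp Require Import all_boot zify.

Set Implicit Arguments.
Unset Strict Implicit.
Unset Printing Implicit Defensive.

(** * Transversals *)

Section Transversal.
Variables (S J : finType) (A : J -> {set S}).
Implicit Type X : {set S}.

Lemma transversal_card X : transversal_matroid A X -> #|X| <= #|J|.
Proof.
case/existsP=> K /existsP[x /and3P[_ _ /eqP->]].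
apply: leq_trans (leq_imset_card _ _) _.
by rewrite card_sig max_card.
Qed.

Lemma transversal_imset (y : J -> S) :
  injective y -> (forall j, y j \in A j) ->
  transversal_matroid A [set y j | j : J].
Proof.
move=> y_inj yA; apply/existsP; exists setT; apply/existsP.
exists [ffun k => y (val k)]; apply/and3P; split.
- by apply/injectiveP=> j1 j2; rewrite !ffunE => /y_inj/val_inj.
- by apply/forallP=> j; rewrite ffunE.
apply/eqP/setP=> z; apply/imsetP/imsetP=> -[j _ ->].
  by exists (Sub j (in_setT j)); rewrite ?ffunE.
by exists (val j); rewrite ?ffunE.
Qed.

(** Counting forces the index set [K] to be all of [J], so the representatives can be indexed by [J]
    itself. *)
Lemma transversal_full X :
  transversal_matroid A X -> #|X| = #|J| ->
  exists y : J -> S,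
    [/\ injective y, forall j, y j \in A j & X = [set y j | j : J]].
Proof.
case/existsP=> K /existsP[x /and3P[/injectiveP x_inj /forallP xA /eqP->]].
rewrite card_imset // card_sig => cardK.
have KT j : j \in K.
  have /eqP-> : K == setT by rewrite eqEcard subsetT cardsT -cardK /=.
  by rewrite inE.
exists (fun j => x (Sub j (KT j))); split.
- by move=> j1 j2 /x_inj /(congr1 val).
- by move=> j; apply: xA.
apply/setP=> z; apply/imsetP/imsetP=> -[j _ ->].
  by exists (val j) => //; apply: (congr1 x); apply: val_inj.
by exists (Sub j (KT j)).
Qed.

(** Independence seen from the elements: [g] sends each element to the set it represents. Such a
    function can be changed at one point, and its values outside [X] are irrelevant. *)
Definition matching X (g : {ffun S -> option J}) : bool :=
  [forall x in X, if g x is Some j then x \in A j else false]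
  && [forall x in X, forall x' in X, (g x == g x') ==> (x == x')].

Lemma matchingP X (g : {ffun S -> option J}) :
  reflect ((forall x, x \in X -> exists2 j, g x = Some j & x \in A j) /\
           {in X &, injective g})
          (matching X g).
Proof.
apply: (iffP andP) => [[/forall_inP gA /forall_inP gI] | [gA gI]].
  split=> [x /gA|x x' /gI/forall_inP H /H/implyP I e].
    by case: (g x) => // j xA; exists j.
  by apply/eqP/I/eqP.
split; apply/forall_inP => x xX.
  by have [j -> ->] := gA x xX.
apply/forall_inP=> x' x'X; apply/implyP=> /eqP e; apply/eqP; exact: gI.
Qed.

Lemma transversal_matching X :
  transversal_matroid A X -> exists g, matching X g.
Proof.
case/existsP=> K /existsP[x /and3P[/injectiveP x_inj /forallP xA /eqP->]].
have pickE k : [pick k' | x k' == x k] = Some k.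
  case: pickP => [k' /eqP/x_inj-> //|/(_ k)]; by rewrite eqxx.
exists [ffun z => omap val [pick k | x k == z]]; apply/matchingP; split.
  by move=> _ /imsetP[k _ ->]; exists (val k); rewrite ?ffunE ?pickE.
move=> _ _ /imsetP[k _ ->] /imsetP[k' _ ->].
by rewrite !ffunE !pickE /= => -[/val_inj->].
Qed.

Lemma matching_transversal X g : matching X g -> transversal_matroid A X.
Proof.
move=> /matchingP[gA gI].
pose K := [set j | [exists x in X, g x == Some j]].
have KP (k : {j | j \in K}) : exists x, (x \in X) && (g x == Some (val k)).
  by apply/existsP; have := valP k; rewrite inE.
pose h k := xchoose (KP k).
have hX k : h k \in X by have /andP[] := xchooseP (KP k).
have gh k : g (h k) = Some (val k) by have /andP[_ /eqP] := xchooseP (KP k).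
apply/existsP; exists K; apply/existsP; exists [ffun k => h k].
apply/and3P; split.
- apply/injectiveP=> k k'; rewrite !ffunE => e; apply: val_inj.
  by have := gh k; rewrite e gh => -[].
- apply/forallP=> k; rewrite ffunE.
  by have [j] := gA _ (hX k); rewrite gh => -[<-].
apply/eqP/setP=> z; apply/idP/imsetP=> [zX|[k _ ->]]; last by rewrite ffunE.
have [j gz _] := gA z zX.
have jK : j \in K by rewrite inE; apply/existsP; exists z; rewrite zX gz eqxx.
exists (Sub j jK) => //; rewrite ffunE; apply: gI => //.
by rewrite gh gz.
Qed.

(* Take a matching of [B] that agrees as often as possible with a full
   transversal [y]; if [j] is unmatched, then [y j] can be (re)matched to [j]. *)
Lemma transversal_basis_card (B : {set S}) :
  rank (transversal_matroid A) = #|J| ->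
  basis (transversal_matroid A) B -> #|B| = #|J|.
Proof.
move=> rankA /maxsetP[indB maxB].
have [Y indY cardY] : exists2 Y, transversal_matroid A Y & #|Y| = #|J|.
  have /(eq_bigmax_cond (fun Y : {set S} => #|Y|))[Y indY e] :
      0 < #|[pred Y : {set S} | transversal_matroid A Y]|.
    by apply/card_gt0P; exists B.
  by exists Y => //; rewrite -e -rankA.
have [y [y_inj yA _]] := transversal_full indY cardY.
apply/eqP; rewrite eqn_leq transversal_card //= leqNgt; apply/negP=> ltB.
have [g0 g0M] := transversal_matching indB.
pose agree (g : {ffun S -> option J}) := #|[set j | g (y j) == Some j]|.
case: (@arg_maxnP _ g0 (matching B) agree g0M) => g /matchingP[gA gI] gmax.
have [j jP] : exists j, forall x, x \in B -> g x != Some j.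
  have : ~~ ([set Some j | j : J] \subset g @: B).
    apply/negP=> /subset_leq_card; rewrite (card_imset _ (@Some_inj _)).
    by move/leq_trans/(_ (leq_imset_card _ _)); rewrite ?cardsT leqNgt ltB.
  case/subsetPn=> _ /imsetP[j _ ->] /imsetP nj.
  by exists j => x xB; apply/eqP=> e; apply: nj; exists x.
pose g' := [ffun x => if x == y j then Some j else g x].
have matching' : matching (y j |: B) g'.
  apply/matchingP; split.
    move=> x; rewrite ffunE !inE; case: eqP => [-> _|_ /= /gA//].
    by exists j.
  move=> x x'; rewrite !inE !ffunE.
  case: eqP => [->|_] /=; case: eqP => [->|_] //=; last exact: gI.
    by move=> _ /jP/eqP ne e; case: ne.
  by move=> /jP/eqP ne _ e; case: ne.
(* If [y j] is in [B], then [g'] agrees with [y] at [j] and wherever [g] did, contradicting the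
   choice of [g]. Otherwise [B] can be enlarged. *)
have [yjB|yjB] := boolP (y j \in B).
  have /gmax : matching B g' by rewrite -(setUidPr _ : y j |: B = B) ?sub1set.
  apply/negP; rewrite -ltnNge; apply: proper_card; apply/properP; split.
    apply/subsetP=> j'; rewrite !inE ffunE.
    case: (y j' =P y j) => [/y_inj->|//].
    by rewrite eqxx.
  exists j; rewrite inE ?ffunE ?eqxx //; exact: jP.
have := maxB _ (matching_transversal matching') (subsetUr _ _).
by move/setP/(_ (y j)); rewrite !inE eqxx (negPf yjB).
Qed.

Lemma transversal_basisE (B : {set S}) :
  rank (transversal_matroid A) = #|J| ->
  basis (transversal_matroid A) B <->
  transversal_matroid A B /\ #|B| = #|J|.
Proof.
move=> rankA; split=> [bB|[indB cardB]].
  by split; [case/maxsetP: bB | apply: transversal_basis_card].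
apply/maxsetP; split=> // X indX sBX; apply/eqP.
by rewrite eq_sym eqEcard sBX cardB transversal_card.
Qed.

End Transversal.

(** * Counting the elements below a bound *)

Section Count.
Variable n : nat.
Implicit Types (X : {set 'I_n}) (u v : 'I_n).

(** A sum of indicators rather than a cardinal, so that counts can be compared term by term. *)
Definition count_below X t : nat := \sum_(x in X) (x < t).

Lemma count_below0 X : count_below X 0 = 0.
Proof. exact: big1. Qed.

Lemma count_belowS X u : count_below X u.+1 = count_below X u + (u \in X).
Proof.
have -> : (u \in X : nat) = \sum_(x in X) (x == u).
  case: (boolP (u \in X)) => uX.
    rewrite (bigD1 u) //= eqxx big1 // => x /andP[_ /negPf->] //.
  by rewrite big1 // => x xX; case: eqP => // e; rewrite -e xX in uX.
rewrite -big_split; apply: eq_bigr => x _ /=.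
by rewrite ltnS leq_eqVlt -val_eqE /=; case: ltngtP.
Qed.

Lemma count_belowT X : count_below X n = #|X|.
Proof. by rewrite -sum1_card; apply: eq_bigr => x _; rewrite ltn_ord. Qed.

Lemma leq_count_below X t t' :
  t <= t' -> count_below X t <= count_below X t'.
Proof.
move=> le_tt'; apply: leq_sum => x _; case: (ltnP x t) => // lt_xt.
by rewrite (leq_trans lt_xt).
Qed.

Lemma count_below_le X t t' :
  t <= t' -> count_below X t' <= count_below X t + (t' - t).
Proof.
elim: t' => [|t' IH]; first by rewrite leqn0 => /eqP->; lia.
rewrite leq_eqVlt => /orP[/eqP->|]; first by lia.
rewrite ltnS => le_tt'; have := IH le_tt'.
have [lt_t'n|] := ltnP t' n; first have /= := count_belowS X (Ordinal lt_t'n).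
  by case: (_ \in X); lia.
move=> le_nt'; suff -> : count_below X t'.+1 = count_below X t' by lia.
by apply: eq_bigr => x _; have := ltn_ord x; lia.
Qed.

Lemma count_below_full X t t' :
  t <= t' -> (forall v, t <= v < t' -> v \in X) -> t' <= n ->
  count_below X t' = count_below X t + (t' - t).
Proof.
elim: t' => [|t' IH]; first by rewrite leqn0 => /eqP->; lia.
rewrite leq_eqVlt => /orP[/eqP->|]; first by lia.
rewrite ltnS => le_tt' full lt_t'n.
have := count_belowS X (Ordinal lt_t'n); rewrite full /=; last by lia.
by have := IH le_tt' (fun v vP => full v ltac:(lia)) (ltnW lt_t'n); lia.
Qed.

Lemma count_below_empty X t t' :
  t <= t' -> (forall v, t <= v < t' -> v \notin X) ->
  count_below X t' = count_below X t.
Proof.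
move=> le_tt' empty; apply: eq_bigr => x xX.
by have := empty x; rewrite xX; lia.
Qed.

(** The count grows from 0 by steps of at most one, so the least [t] at which it exceeds [q] comes
    right after the desired element. *)
Lemma count_below_nth X q :
  q < #|X| -> exists2 x : 'I_n, x \in X & count_below X x = q.
Proof.
rewrite -count_belowT => lt_q.
have exq : exists t, q < count_below X t by exists n.
case: (ex_minnP exq) => -[|t]; first by rewrite count_below0.
move=> gtq min_t; have lt_tn : t < n by apply: min_t.
have := count_belowS X (Ordinal lt_tn).
have := min_t t; move: gtq; rewrite /= => gtq min_t' step.
exists (Ordinal lt_tn); last first.
  by move: step => /=; case: (_ \in X); lia.
by move: step; case: (_ \in X) => //; lia.
Qed.

Lemma count_below_exchange X u v t :
  u \in X -> v \notin X ->
  count_below (v |: X :\ u) t + (u < t) = count_below X t + (v < t).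
Proof.
move=> uX vX; rewrite /count_below big_setU1 /=; last first.
  by rewrite !inE (negPf vX) andbF.
by rewrite (big_setD1 u uX) /= addnAC [RHS]addnAC [(u < t) + _]addnC.
Qed.

Lemma count_below_imset (J : finType) (h : J -> 'I_n) t :
  injective h -> count_below [set h j | j : J] t = \sum_j (h j < t).
Proof.
by move=> h_inj; rewrite /count_below big_imset //=; apply: in2W.
Qed.

Lemma PiE X p t :
  t <= n -> Pi X p t = (p.1 + (t - count_below X t), p.2 + count_below X t).
Proof.
elim: t => [|t IH] lt_tn.
  by rewrite /Pi take0 /= count_below0 subn0 !addn0 -surjective_pairing.
have le_t : count_below X t <= t.
  by have := count_below_le X (leq0n t); rewrite count_below0; lia.
move: (IH (ltnW lt_tn)) le_t; rewrite /Pi => IHt.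
rewrite (take_nth (Ordinal lt_tn)) ?size_enum_ord // foldl_rcons IHt.
have -> : nth (Ordinal lt_tn) (enum 'I_n) t = Ordinal lt_tn.
  by apply: val_inj; rewrite /= nth_enum_ord.
rewrite (count_belowS X (Ordinal lt_tn)) /=.
by case: (_ \in X) => le_t; rewrite /north /east /=; congr pair; lia.
Qed.

(** Every step raises the sum of the coordinates by one, so paths starting on the same antidiagonal
    can only meet after equally many steps; there, only heights need comparing. *)
Lemma Pi_eq X Y p q t t' :
  t <= n -> t' <= n -> p.1 + p.2 = q.1 + q.2 ->
  Pi X p t = Pi Y q t' <->
  t = t' /\ p.2 + count_below X t = q.2 + count_below Y t.
Proof.
move=> le_tn le_t'n epq; rewrite !PiE //.
have := count_below_le X (leq0n t); have := count_below_le Y (leq0n t').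
rewrite !count_below0 => leY leX; split=> [[e1 e2]|[et e2]].
  have et : t = t' by lia.
  by move: e1 e2; rewrite -et.
by rewrite -et in leY *; congr pair; lia.
Qed.

End Count.

(** * Intervals of the cycle *)

Section CyclicInterval.
Variable n : nat.
Implicit Types f l x : 'I_n.

Lemma iter_ordS f k : iter k (@ordS n) f = (f + k) %% n :> nat.
Proof.
elim: k => [|k IH]; first by rewrite addn0 modn_small.
by rewrite iterS /= IH -addn1 modnDml addn1 addnS.
Qed.

Definition cycle_dist f l : nat := if f <= l then l - f else n + l - f.

Lemma cycle_dist_lt f l : cycle_dist f l < n.
Proof.
have := ltn_ord f; have := ltn_ord l.
by rewrite /cycle_dist; case: (leqP f l); lia.
Qed.

Lemma iter_cycle_dist f l : iter (cycle_dist f l) (@ordS n) f = l.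
Proof.
apply: val_inj; rewrite /= iter_ordS /cycle_dist; have lt_fn := ltn_ord f.
case: leqP => [le_fl|lt_lf]; first by rewrite subnKC // modn_small.
rewrite subnKC; last by lia.
by rewrite modnDl modn_small.
Qed.

Lemma order_ordS f : order (@ordS n) f = n.
Proof.
rewrite /order -[RHS]card_ord; apply: eq_card => x; rewrite !inE.
by rewrite -(iter_cycle_dist f x) fconnect_iter.
Qed.

Lemma findex_ordS f l : findex (@ordS n) f l = cycle_dist f l.
Proof.
rewrite -[in LHS](iter_cycle_dist f l) findex_iter //.
by rewrite order_ordS cycle_dist_lt.
Qed.

(** Membership means that [x] is no farther than [l] from [f] along the cycle. *)
Lemma mem_sigma_interval f l x :
  (x \in sigma_interval (@ordS n) f l) =
  if f <= l then f <= x <= l else (f <= x) || (x <= l).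
Proof.
have -> : (x \in sigma_interval (@ordS n) f l) =
          (cycle_dist f x <= cycle_dist f l).
  rewrite inE findex_ordS; apply/trajectP/idP => [[k lt_k ->]|le_d].
    have lt_kn := leq_trans lt_k (cycle_dist_lt _ _).
    by rewrite -findex_ordS findex_iter ?order_ordS.
  by exists (cycle_dist f x); rewrite ?iter_cycle_dist.
have := ltn_ord f; have := ltn_ord l; have := ltn_ord x.
by rewrite /cycle_dist; case: (leqP f x); case: (leqP f l); lia.
Qed.

End CyclicInterval.

(** * Bases and valid paths *)

Section Bases.
Variables (n r : nat) (I : 'I_r -> 'I_n * 'I_n).
Hypothesis antichainI : antichain (interval I).
Implicit Types (j : 'I_r) (X : {set 'I_n}) (s t : nat).

Let F := fst_elt I.
Let L := lst_elt I.

Definition wraps j : bool := lst_elt I j < fst_elt I j.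
Definition nb_wraps : nat := \sum_j wraps j.
Definition lasts_below t : nat := \sum_j (lst_elt I j < t).
Definition firsts_below t : nat := \sum_j (fst_elt I j < t).

(* For [s = i - 1], this is the validity of [Pi X p_i] in terms of heights. *)
Definition fits X s : Prop :=
  forall t, t <= n ->
    lasts_below t <= s + count_below X t <= nb_wraps + firsts_below t.

Lemma mem_interval j (x : 'I_n) :
  (x \in interval I j) = if wraps j then (F j <= x) || (x <= L j)
                         else F j <= x <= L j.
Proof. by rewrite mem_sigma_interval /wraps ltnNge; case: leqP. Qed.

(** Witnesses of the two non-inclusions exclude all other arrangements of the endpoints. Intervals
    that both wrap, or both do not, are ordered alike by first and by last elements; a wrapping one
    ends before and begins after a non-wrapping one. *)
Lemma antichain_endpoints j j' : j != j' ->
  [/\ F j != F j' :> nat, L j != L j' :> nat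
    & (L j' < L j) + wraps j = (F j' < F j) + wraps j'].
Proof.
move=> ne; have ne' : j' != j by rewrite eq_sym.
have /subsetPn[x] := antichainI ne; have /subsetPn[y] := antichainI ne'.
rewrite !mem_interval /wraps -/F -/L.
have := ltn_ord x; have := ltn_ord y.
move: (nat_of_ord x) (nat_of_ord y) => a b.
case: (ltnP (L j) (F j)); case: (ltnP (L j') (F j')) => *; split; lia.
Qed.

Lemma fst_elt_inj : injective F.
Proof.
move=> j j' e; apply/eqP; apply: contraT => /antichain_endpoints[].
by rewrite e eqxx.
Qed.

Lemma lst_elt_inj : injective L.
Proof.
move=> j j' e; apply/eqP; apply: contraT => /antichain_endpoints[_].
by rewrite e eqxx.
Qed.

(** Sum of the previous equation over all [j']: the rank of an interval by last elements is its rank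
    by first elements rotated by [nb_wraps] modulo [r]. *)
Lemma lasts_below_lst j :
  lasts_below (L j) + wraps j * r = firsts_below (F j) + nb_wraps.
Proof.
have -> : wraps j * r = \sum_(j' < r) wraps j.
  by rewrite sum_nat_const card_ord mulnC.
rewrite -!big_split; apply: eq_bigr => j' _ /=.
have [->|/antichain_endpoints[_ _ //]] := eqVneq j j'.
by rewrite -/F -/L !ltnn.
Qed.

Lemma lasts_belowE t :
  lasts_below t = count_below [set lst_elt I j | j : 'I_r] t.
Proof. by rewrite count_below_imset //; apply: lst_elt_inj. Qed.

Lemma firsts_belowE t :
  firsts_below t = count_below [set fst_elt I j | j : 'I_r] t.
Proof. by rewrite count_below_imset //; apply: fst_elt_inj. Qed.

Lemma lasts_belowT : lasts_below n = r.
Proof.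
rewrite lasts_belowE count_belowT card_imset ?card_ord //.
exact: lst_elt_inj.
Qed.

Lemma firsts_belowT : firsts_below n = r.
Proof.
rewrite firsts_belowE count_belowT card_imset ?card_ord //.
exact: fst_elt_inj.
Qed.

Lemma lasts_below_lt j t : L j < t -> lasts_below (L j) < lasts_below t.
Proof.
rewrite !lasts_belowE => /(leq_count_below [set lst_elt I j | j : 'I_r]).
by rewrite count_belowS imset_f // addn1.
Qed.

Lemma transversal_fits X :
  transversal_matroid (interval I) X -> #|X| = r -> exists s, fits X s.
Proof.
move=> indX cardX; have [|y [y_inj yI defX]] := transversal_full indX.
  by rewrite card_ord.
have cntX t : count_below X t = \sum_j (y j < t).
  by rewrite defX count_below_imset.
(* Each lower bound on [s], at [t], is at most each upper bound, at [t']. The inequality holds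
   separately for each [j], because [y j] lies in its interval. *)
have bounds t t' : lasts_below t + count_below X t' <=
                   nb_wraps + firsts_below t' + count_below X t.
  rewrite !cntX -!big_split; apply: leq_sum => j _ /=.
  have := yI j; rewrite mem_interval /wraps -/F -/L.
  move: (nat_of_ord (y j)) (nat_of_ord (F j)) (nat_of_ord (L j)) => a f l.
  by case: (ltnP l f); case: (ltnP l t); case: (ltnP a t'); case: (ltnP f t');
     case: (ltnP a t); lia.
(* The largest of the lower bounds; truncating negative ones to 0 is harmless. *)
pose s := \max_(t < n.+1) (lasts_below t - count_below X t).
exists s => t le_tn; apply/andP; split.
  have := leq_bigmax (F := fun t : 'I_n.+1 => lasts_below t - count_below X t)
                     (Ordinal (le_tn : t < n.+1)).
  by rewrite -/s /=; lia.
(* This makes the subtraction in the upper bound below exact. *)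
have lb : count_below X t <= nb_wraps + firsts_below t.
  by have := bounds 0 t; rewrite count_below0; lia.
suff : s <= nb_wraps + firsts_below t - count_below X t by lia.
by apply/bigmax_leqP=> t' _; have := bounds t' t; lia.
Qed.

Lemma fits_transversal X s :
  #|X| = r -> fits X s -> transversal_matroid (interval I) X.
Proof.
move=> cardX fitX.
(* The first bound is validity at [t = 0]. Together they give [s <= r], which keeps the subtractions
   in [q] exact. *)
have [le_sc le_cr] : s <= nb_wraps /\ nb_wraps <= r.
  split; last first.
    rewrite -[X in _ <= X]card_ord -sum1_card.
    by apply: leq_sum => j _; case: wraps.
  have := fitX 0 isT; rewrite count_below0.
  suff -> : firsts_below 0 = 0 by lia.
  by rewrite firsts_belowE count_below0.
have lst_lt j : lasts_below (L j) < r.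
  by rewrite -[X in _ < X]lasts_belowT; apply/lasts_below_lt/ltn_ord.
(* The rank of the last element minus [s], modulo [r]: the position in [X], from 0, of the
   representative of [j]. *)
pose q j := if s <= lasts_below (L j) then lasts_below (L j) - s
            else lasts_below (L j) + r - s.
have q_lt j : q j < #|X|.
  by rewrite cardX /q; have := lst_lt j; case: (leqP s _); lia.
have exy j : exists x : 'I_n, (x \in X) && (count_below X x == q j).
  by have [x xX <-] := count_below_nth (q_lt j); exists x; rewrite xX eqxx.
pose y j := xchoose (exy j).
have yX j : y j \in X by have /andP[] := xchooseP (exy j).
have yq j : count_below X (y j) = q j by have /andP[_ /eqP] := xchooseP (exy j).
have y_inj : injective y.
  move=> j j' e; have := yq j; rewrite e yq /q => eq_q.
  have eL : lasts_below (L j) = lasts_below (L j').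
    have := lst_lt j; have := lst_lt j'; move: eq_q.
    by case: (leqP s (lasts_below (L j))); case: (leqP s (lasts_below (L j')));
      lia.
  apply: lst_elt_inj; apply: val_inj => /=.
  by case: (ltngtP (L j) (L j')) => // /lasts_below_lt; rewrite eL ltnn.
have yI j : y j \in interval I j.
  (* The lower bound is read just before the step of [y j] and the upper bound just after it. *)
  have /andP[lo _] := fitX (y j) (ltnW (ltn_ord _)).
  have /andP[_ hi] := fitX (y j).+1 (ltn_ord _).
  move: hi; rewrite count_belowS yX yq => hi; rewrite yq in lo.
  have rot := lasts_below_lst j.
  have lst_ge : lasts_below (y j) <= lasts_below (L j) -> y j <= L j.
    by apply: contraLR; rewrite -!ltnNge; apply: lasts_below_lt.
  have fst_le : firsts_below (F j) < firsts_below (y j).+1 -> F j <= y j.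
    apply: contraLR; rewrite -ltnNge -leqNgt => lt_yF.
    by rewrite !firsts_belowE; apply: leq_count_below.
  move: lo hi rot; rewrite mem_interval /q.
  (* Without reduction modulo [r], [lo] gives [y j <= L j], which suffices if [j] wraps; otherwise
     [hi] and [rot] add [F j <= y j]. With reduction, a wrapping [j] gets [F j <= y j], and a
     non-wrapping one is impossible, since [rot] gives [s <= nb_wraps <= lasts_below (L j)]. *)
  case: (leqP s (lasts_below (L j))) => cmp; case: (wraps j) => lo hi rot.
  - by rewrite lst_ge ?orbT //; lia.
  - by rewrite fst_le ?lst_ge //; lia.
  - by rewrite fst_le //; lia.
  - by lia.
have -> : X = [set y j | j : 'I_r].
  apply/eqP; rewrite eq_sym eqEcard card_imset // card_ord cardX leqnn andbT.
  by apply/subsetP=> _ /imsetP[j _ ->].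
exact: transversal_imset.
Qed.

Lemma basis_fits X :
  rank (transversal_matroid (interval I)) = r ->
  basis (transversal_matroid (interval I)) X <->
  #|X| = r /\ exists s, fits X s.
Proof.
rewrite -[r in rank _ = r]card_ord => /transversal_basisE H.
split=> [/H[indX]|[cardX [s fitX]]].
  by rewrite card_ord => cardX; split=> //; apply: transversal_fits.
by apply/H; rewrite card_ord; split=> //; apply: fits_transversal fitX.
Qed.

End Bases.

(** * Validity and contact with the borders as conditions on heights *)

Section Paths.
Variables (n r : nat) (I : 'I_r -> 'I_n * 'I_n).
Hypothesis antichainI : antichain (interval I).
Implicit Types (X : {set 'I_n}) (i t : nat) (u : 'I_n).

(** An interval wraps exactly when it contains the least element without beginning there. *)
Lemma diag_kE : diag_k I = (nb_wraps I).+1.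
Proof.
rewrite /diag_k /nb_wraps -sum1_card big_mkcond /=; congr S.
apply: eq_bigr => j _; rewrite inE.
rewrite -[RHS]/(nat_of_bool _); congr nat_of_bool.
apply/existsP/idP=> [[e]|wj].
  rewrite mem_interval -val_eqE /= => /and3P[/eqP-> + ne].
  case: (wraps I j) => // /andP[]; move: ne.
  by rewrite leqn0 eq_sym => /negPf->.
have n_gt0 : 0 < n by apply: leq_trans (ltn_ord (fst_elt I j)).
exists (Ordinal n_gt0); rewrite mem_interval wj -val_eqE /= orbT /=.
by rewrite eq_sym -lt0n; exact: leq_trans wj.
Qed.

(** All the points [diag_pt I i] lie on one antidiagonal, so [Pi_eq] applies; [i.-1] is the starting
    height. *)
Lemma Pi_bottomE X i t t' :
  1 <= i <= diag_k I -> t <= n -> t' <= n ->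
  Pi X (diag_pt I i) t = bottom_border I t' <->
  t = t' /\ i.-1 + count_below X t = lasts_below I t.
Proof.
move=> i_range le_tn le_t'n; rewrite lasts_belowE //.
have Epq : (diag_pt I i).1 + (diag_pt I i).2 =
           (diag_pt I 1).1 + (diag_pt I 1).2 by rewrite /=; lia.
have := Pi_eq X [set lst_elt I j | j : 'I_r] le_tn le_t'n Epq.
by rewrite /= subn1 subnn add0n.
Qed.

Lemma Pi_topE X i t t' :
  1 <= i <= diag_k I -> t <= n -> t' <= n ->
  Pi X (diag_pt I i) t = top_border I t' <->
  t = t' /\ i.-1 + count_below X t = nb_wraps I + firsts_below I t.
Proof.
move=> i_range le_tn le_t'n; rewrite firsts_belowE //.
have Epq : (diag_pt I i).1 + (diag_pt I i).2 =
           (diag_pt I (diag_k I)).1 + (diag_pt I (diag_k I)).2.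
  by rewrite /=; lia.
have := Pi_eq X [set fst_elt I j | j : 'I_r] le_tn le_t'n Epq.
have e : diag_k I - 1 = nb_wraps I by rewrite diag_kE subn1.
by rewrite /= e subn1.
Qed.

Lemma valid_fits X i :
  1 <= i <= diag_k I -> valid_path I (Pi X (diag_pt I i)) -> fits I X i.-1.
Proof.
move=> i_range validX t le_tn; have [t' le_t'n []] := validX t le_tn.
rewrite /top_border /bottom_border !PiE //= -lasts_belowE // -firsts_belowE //.
have := count_below_le X (leq0n t); rewrite count_below0 => le_t sum_t _.
(* The sum of the coordinates determines the number of steps. *)
have <- : t = t' by move: sum_t; lia.
by rewrite diag_kE; lia.
Qed.

Lemma step_lies_in_top X i u :
  1 <= i <= diag_k I ->
  step_lies_in (Pi X (diag_pt I i)) u (top_border I) <->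
  i.-1 + count_below X u = nb_wraps I + firsts_below I u /\
  i.-1 + count_below X u.+1 = nb_wraps I + firsts_below I u.+1.
Proof.
move=> i_range; have lt_un := ltn_ord u; split.
  case=> t [lt_tn /Pi_topE E1 /Pi_topE E2].
  have [_ ->] := E1 i_range (ltnW lt_un) (ltnW lt_tn).
  by have [_ ->] := E2 i_range lt_un lt_tn.
by case=> e1 e2; exists u; split=> //; apply/Pi_topE => //; apply: ltnW.
Qed.

Lemma step_lies_in_bottom X i u :
  1 <= i <= diag_k I ->
  step_lies_in (Pi X (diag_pt I i)) u (bottom_border I) <->
  i.-1 + count_below X u = lasts_below I u /\
  i.-1 + count_below X u.+1 = lasts_below I u.+1.
Proof.
move=> i_range; have lt_un := ltn_ord u; split.
  case=> t [lt_tn /Pi_bottomE E1 /Pi_bottomE E2].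
  have [_ ->] := E1 i_range (ltnW lt_un) (ltnW lt_tn).
  by have [_ ->] := E2 i_range lt_un lt_tn.
by case=> e1 e2; exists u; split=> //; apply/Pi_bottomE => //; apply: ltnW.
Qed.

Lemma touches_after_bottom X i u :
  1 <= i <= diag_k I ->
  touches_after (Pi X (diag_pt I i)) u (bottom_border I) <->
  exists2 t, u < t <= n & i.-1 + count_below X t = lasts_below I t.
Proof.
move=> i_range; split=> [[t [t' [lt_ut le_tn le_t'n /Pi_bottomE E]]]|].
  by exists t; [rewrite lt_ut | have [] := E i_range le_tn le_t'n].
case=> t /andP[lt_ut le_tn] e; exists t, t; split=> //.
by apply/Pi_bottomE.
Qed.

Lemma touches_after_top X i u :
  1 <= i <= diag_k I ->
  touches_after (Pi X (diag_pt I i)) u (top_border I) <->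
  exists2 t, u < t <= n &
    i.-1 + count_below X t = nb_wraps I + firsts_below I t.
Proof.
move=> i_range; split=> [[t [t' [lt_ut le_tn le_t'n /Pi_topE E]]]|].
  by exists t; [rewrite lt_ut | have [] := E i_range le_tn le_t'n].
case=> t /andP[lt_ut le_tn] e; exists t, t; split=> //.
by apply/Pi_topE.
Qed.

End Paths.

(** * Activities *)

Section Activities.
Variables (n r : nat) (I : 'I_r -> 'I_n * 'I_n).
Hypothesis antichainI : antichain (interval I).
Hypothesis rankI : rank (transversal_matroid (interval I)) = r.
Variables (B : {set 'I_n}) (s : nat).
Hypotheses (cardB : #|B| = r) (fitB : fits I B s).
Implicit Types (u v : 'I_n) (t : nat).

Local Notation b := (count_below B).
Local Notation lam := (lasts_below I).
Local Notation phi := (firsts_below I).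
Local Notation c := (nb_wraps I).
Local Notation M := (transversal_matroid (interval I)).

Lemma firsts_below_le t t' : t <= t' -> phi t' <= phi t + (t' - t).
Proof. by rewrite !firsts_belowE //; apply: count_below_le. Qed.

Lemma leq_lasts_below t t' : t <= t' -> lam t <= lam t'.
Proof. by rewrite !lasts_belowE //; apply: leq_count_below. Qed.

(** [fits] for the exchanged set, with the indicators placed so that nothing is subtracted. The new
    basis may need another starting point, hence a free [s']; the order of [u] and [v] is left open
    to serve both kinds of activity. *)
Lemma basis_exchange u v : u \in B -> v \notin B ->
  basis M (v |: B :\ u) <->
  exists s', forall t, t <= n ->
    lam t + (u < t) <= s' + b t + (v < t) <= c + phi t + (u < t).
Proof.
move=> uB vB; have card' : #|v |: B :\ u| = r.
  have := count_below_exchange n uB vB.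
  by rewrite !count_belowT !ltn_ord cardB => /addIn.
split=> [/(basis_fits antichainI _ rankI)[_ [s' fit']]|[s' fit']].
  exists s' => t le_tn; have := fit' t le_tn.
  by have := count_below_exchange t uB vB; lia.
apply/(basis_fits antichainI _ rankI); split=> //; exists s' => t le_tn.
by have := fit' t le_tn; have := count_below_exchange t uB vB; lia.
Qed.

Lemma internally_activeE u : u \in B ->
  internally_active M (fun x y => x < y) B u <->
  [set v : 'I_n | v <= u] \subset B \/
  (s + b u = c + phi u /\ s + b u.+1 = c + phi u.+1) /\
  exists2 t, u < t <= n & s + b t = lam t.
Proof.
move=> uB; split=> [[_ noex]|act].
  case: (boolP ([set v : 'I_n | v <= u] \subset B)) => [|/subsetPn[v0]].
    by left.
  rewrite inE => le_v0u v0B; right.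
  have lt_v0u : v0 < u.
    by rewrite ltn_neqAle le_v0u andbT; apply: contraNneq v0B => /val_inj->.
  have P0 : (v0 \notin B) && (v0 < u) by rewrite v0B.
  (* Off [Q], take the largest [v] and keep [s]: the path rises by one between [v] and [u]. There it
     only goes North while [Q] climbs at most one per step, so the gap at [u] persists backwards. *)
  have [/eqP onQ|offQ] := boolP (s + b u == c + phi u); last first.
    case: noex.
    case: (@arg_maxnP _ v0 (fun v => (v \notin B) && (v < u)) val P0).
    move=> v /andP[vB lt_vu] max_v; exists v; split=> //.
    apply/basis_exchange => //; exists s => t le_tn; have := fitB le_tn.
    have := fitB (ltnW (ltn_ord u)).
    case: (ltnP u t); case: (ltnP v t) => lt_vt le_tu; try lia.
    have := @count_below_full _ B t u le_tu _ (ltnW (ltn_ord u)).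
    have := firsts_below_le le_tu.
    suff full v' : t <= v' < u -> v' \in B by move=> ? /(_ full); lia.
    move=> /andP[le_tv' lt_v'u]; apply: contraT => v'B.
    by have := max_v v'; rewrite v'B lt_v'u => /(_ isT); rewrite /=; lia.
  split.
    (* The path goes North from a point of [Q] and may not cross it, so [Q] goes North too. *)
    split=> //; have := fitB (ltn_ord u); have := firsts_below_le (leqnSn u).
    by rewrite count_belowS uB; lia.
  case: (boolP [exists t : 'I_n.+1, (u < t) && (s + b t == lam t)]).
    case/existsP=> t /andP[lt_ut /eqP onP]; exists t => //.
    by rewrite lt_ut -ltnS ltn_ord.
  rewrite negb_exists => /forallP offP.
  have gt_lam t : u < t -> t <= n -> lam t < s + b t.
    move=> lt_ut le_tn; have := offP (Ordinal (le_tn : t < n.+1)).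
    by have := fitB le_tn; rewrite /= lt_ut; lia.
  (* At [t = n] both counts equal [r], so missing [P] there means [s > 0]. *)
  have s_gt0 : 0 < s.
    have := gt_lam n (ltn_ord u) (leqnn n).
    by rewrite count_belowT lasts_belowT //; lia.
  case: noex; case: (@arg_minnP _ v0 (fun v => (v \notin B) && (v < u)) val P0).
  move=> v /andP[vB lt_vu] min_v; exists v; split=> //.
  (* Past [u] the path drops by one, allowed since it misses [P]; between [v] and [u] it is
     unchanged. Up to the smallest [v], [B] contains everything, so [b t = t] is at least
     [lam t]. *)
  apply/basis_exchange => //; exists s.-1 => t le_tn; have := fitB le_tn.
  case: (ltnP u t) => [lt_ut|le_tu].
    by have := gt_lam t lt_ut le_tn; rewrite (ltn_trans lt_vu lt_ut); lia.
  case: (ltnP v t) => [lt_vt|le_tv]; first by lia.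
  have := @count_below_full _ B 0 t (leq0n t) _ le_tn.
  have := count_below_le [set lst_elt I j | j : 'I_r] (leq0n t).
  rewrite -lasts_belowE // !count_below0.
  suff full v' : 0 <= v' < t -> v' \in B by move=> ? /(_ full); lia.
  move=> lt_v't; apply: contraT => v'B.
  have lt_v'u : v' < u by apply: leq_trans lt_v't le_tu.
  by have := min_v v'; rewrite v'B lt_v'u => /(_ isT); rewrite /=; lia.
split=> // -[v [vB lt_vu /(basis_exchange uB vB)[s' fit']]].
case: act => [/subsetP/(_ v)|[[onQ _] [t /andP[lt_ut le_tn] onP]]].
  by rewrite inE (negPf vB) (ltnW lt_vu) => /(_ isT).
(* Being on [Q] at [u] forces [s' < s], while touching [P] at [t] forces [s <= s']. *)
have := fit' u (ltnW (ltn_ord u)); have := fit' t le_tn.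
by rewrite lt_ut lt_vu (ltn_trans lt_vu) // ltnn; lia.
Qed.

(** The mirror image of the internal case: [P] and [Q], North and East, and the two directions of
    shifting trade places. *)
Lemma externally_activeE u : u \notin B ->
  externally_active M (fun x y => x < y) B u <->
  [set v : 'I_n | v <= u] :&: B = set0 \/
  (s + b u = lam u /\ s + b u.+1 = lam u.+1) /\
  exists2 t, u < t <= n & s + b t = c + phi t.
Proof.
move=> uB; split=> [[_ noex]|act].
  have [->|/set0Pn[v0]] := eqVneq ([set v : 'I_n | v <= u] :&: B) set0.
    by left.
  rewrite !inE => /andP[le_v0u v0B]; right.
  have lt_v0u : v0 < u.
    by rewrite ltn_neqAle le_v0u andbT; apply: contraNneq uB => /val_inj<-.
  have P0 : (v0 \in B) && (v0 < u) by rewrite v0B.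
  have [/eqP onP|offP] := boolP (s + b u == lam u); last first.
    case: noex.
    case: (@arg_maxnP _ v0 (fun v => (v \in B) && (v < u)) val P0).
    move=> v /andP[vB lt_vu] max_v; exists v; split=> //.
    apply/basis_exchange => //; exists s => t le_tn; have := fitB le_tn.
    have := fitB (ltnW (ltn_ord u)).
    case: (ltnP u t); case: (ltnP v t) => lt_vt le_tu; try lia.
    (* Between [v] and [u] the path only goes East and [P] never descends, so the gap at [u]
       persists backwards. *)
    have := @count_below_empty _ B t u le_tu; have := leq_lasts_below le_tu.
    suff empty v' : t <= v' < u -> v' \notin B by move=> ? /(_ empty); lia.
    move=> /andP[le_tv' lt_v'u]; apply/negP=> v'B.
    by have := max_v v'; rewrite v'B lt_v'u => /(_ isT); rewrite /=; lia.
  split.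
    split=> //; have := fitB (ltn_ord u); have := leq_lasts_below (leqnSn u).
    by rewrite count_belowS (negPf uB); lia.
  case: (boolP [exists t : 'I_n.+1, (u < t) && (s + b t == c + phi t)]).
    case/existsP=> t /andP[lt_ut /eqP onQ]; exists t => //.
    by rewrite lt_ut -ltnS ltn_ord.
  rewrite negb_exists => /forallP offQ.
  have lt_phi t : u < t -> t <= n -> s + b t < c + phi t.
    move=> lt_ut le_tn; have := offQ (Ordinal (le_tn : t < n.+1)).
    by have := fitB le_tn; rewrite /= lt_ut; lia.
  have lt_sc : s < c.
    have := lt_phi n (ltn_ord u) (leqnn n).
    by rewrite count_belowT firsts_belowT //; lia.
  case: noex; case: (@arg_minnP _ v0 (fun v => (v \in B) && (v < u)) val P0).
  move=> v /andP[vB lt_vu] min_v; exists v; split=> //.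
  (* Past [u] the raised path has room since it misses [Q]; up to the smallest [v], [b t = 0] and
     [s < c] suffices. *)
  apply/basis_exchange => //; exists s.+1 => t le_tn; have := fitB le_tn.
  case: (ltnP u t) => [lt_ut|le_tu].
    by have := lt_phi t lt_ut le_tn; rewrite (ltn_trans lt_vu lt_ut); lia.
  case: (ltnP v t) => [lt_vt|le_tv]; first by lia.
  have := @count_below_empty _ B 0 t (leq0n t).
  rewrite count_below0.
  suff empty v' : 0 <= v' < t -> v' \notin B by move=> /(_ empty); lia.
  move=> lt_v't; apply/negP=> v'B.
  have lt_v'u : v' < u by apply: leq_trans lt_v't le_tu.
  by have := min_v v'; rewrite v'B lt_v'u => /(_ isT); rewrite /=; lia.
split=> // -[v [vB lt_vu /(basis_exchange vB uB)[s' fit']]].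
case: act => [/setP/(_ v)|[[onP _] [t /andP[lt_ut le_tn] onQ]]].
  by rewrite !inE vB (ltnW lt_vu).
(* Being on [P] at [u] forces [s < s'], while touching [Q] at [t] forces [s' <= s]. *)
have := fit' u (ltnW (ltn_ord u)); have := fit' t le_tn.
by rewrite lt_ut lt_vu (ltn_trans lt_vu) // ltnn; lia.
Qed.

End Activities.

Theorem theorem5p3 (m r : nat) (I : 'I_r -> 'I_(m + r) * 'I_(m + r))
    (antichainI : antichain (interval I))
    (rankM : rank (transversal_matroid (interval I)) = r)
    (nullityM : nullity (transversal_matroid (interval I)) = m)
    (B : {set 'I_(m + r)})
    (basisB : basis (transversal_matroid (interval I)) B)
    (i : nat) (i_range : 1 <= i <= diag_k I)
    (valid_i : valid_path I (Pi B (diag_pt I i))) :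
  (forall u : 'I_(m + r), u \in B ->
     internally_active (transversal_matroid (interval I))
         (fun x y : 'I_(m + r) => x < y) B u <->
     [set v : 'I_(m + r) | v <= u] \subset B \/
     (step_lies_in (Pi B (diag_pt I i)) u (top_border I) /\
      touches_after (Pi B (diag_pt I i)) u (bottom_border I))) /\
  (forall u : 'I_(m + r), u \notin B ->
     externally_active (transversal_matroid (interval I))
         (fun x y : 'I_(m + r) => x < y) B u <->
     [set v : 'I_(m + r) | v <= u] :&: B = set0 \/
     (step_lies_in (Pi B (diag_pt I i)) u (bottom_border I) /\
      touches_after (Pi B (diag_pt I i)) u (top_border I))).
Proof.
have fitB := valid_fits antichainI i_range valid_i.
have [cardB _] := (basis_fits antichainI B rankM).1 basisB.
split=> u uB.
  rewrite step_lies_in_top // touches_after_bottom //.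
  exact: internally_activeE.
rewrite step_lies_in_bottom // touches_after_top //.
exact: externally_activeE.
Qed.
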